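(* Let $E$ be a locally complete locally convex Hausdorff space over $\mathbb{C}$ whose topology is given by the directed fundamental system of seminorms $(p_\alpha)_{\alpha\in\mathfrak{A}}$, let $f\colon\mathbb{C}^{d}\to E$ be holomorphic and $k\in\mathbb{N}_0$. Then the following assertions are equivalent. a) $f$ is a polynomial of degree $\le k$. b) For every $\alpha\in\mathfrak{A}$ there exist $C,R>0$ such that for all $z\in\mathbb{C}^{d}$ with $|z|\ge R$: $\ p_\alpha(f(z))\le C|z|^{k}$.
   Context: $E$ is a non-trivial locally convex Hausdorff space with completion $\widehat{E}$. For a bounded, absolutely convex set (disk) $D\subset E$ put $E_D:=\bigcup_{n\in\mathbb{N}}nD$ normed by the gauge of $D$; $E$ is locally complete if $E_D$ is a Banach space for every closed disk $D$. $f\colon\Omega\to E$, $\Omega\subset\mathbb{C}^d$ open, is holomorphic if for every $z\in\Omega$ there is a $\mathbb{C}$-linear map $df(z)\colon\mathbb{C}^d\to\widehat{E}$ with $\lim_{w\to z,\,w\in\Omega,\,w\ne z}\frac{f(w)-f(z)-df(z)[w-z]}{|w-z|}=0$ in $\widehat{E}$, and $df(\cdot)[v]\colon\Omega\to\widehat{E}$ is continuous for every $v\in\mathbb{C}^d$. $|\cdot|$ is the Euclidean norm on $\mathbb{C}^d$. A polynomial of degree $\le k$ is a function of the form $z\mapsto\sum_{|\beta|\le k}a_\beta z^\beta$ with $a_\beta\in E$, $\beta\in\mathbb{N}_0^d$, $|\beta|=\sum_j\beta_j$, $z^\beta=\prod_jz_j^{\beta_j}$. *)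

(* Defs.v *)
From HB Require Import structures.
From mathcomp Require Export all_boot all_order all_algebra.
From mathcomp Require Export complex.
From mathcomp Require Export all_classical all_reals all_analysis.
Export numFieldNormedType.Exports.
Set Implicit Arguments.
Unset Strict Implicit.
Unset Printing Implicit Defensive.
Import Order.TTheory GRing.Theory Num.Theory.

Local Open Scope classical_set_scope.
Local Open Scope complex_scope.
Local Open Scope ring_scope.

(* Naming R[i] as a numFieldType gives it (and 'rV[Cplx R]_d) the library
   topology, whose canonical instances are attached to numFieldType. *)
Definition Cplx (R : realType) : numFieldType := R[i].

(* The norm of R[i] takes its values in R[i]; cabs is the same number in R. *)
Definition cabs (R : realType) (a : Cplx R) : R := complex.Re `|a|.

Definition enorm (R : realType) (d : nat) (z : 'rV[Cplx R]_d) : R :=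
  Num.sqrt (\sum_j cabs (z ord0 j) ^+ 2).

Section LocallyConvex.
Context (R : realType) (E : tvsType (Cplx R)).
Implicit Types (D U : set E) (x y : E).

Definition rscale (t : R) x : E := ((t%:C : R[i]) : Cplx R) *: x.

Definition is_seminorm (p : E -> R) : Prop :=
  [/\ forall x, 0 <= p x,
      forall x y, p (x + y) <= p x + p y
    & forall (a : Cplx R) x, p (a *: x) = cabs a * p x].

(* Directedness is up to a constant; the last clause says that the sets
   {p_i < e} form a basis of neighbourhoods of 0 in E. *)
Definition directed_fundamental_system (I : Type) (p : I -> E -> R) : Prop :=
  [/\ forall i, is_seminorm (p i),
      forall i j, exists k, exists2 c : R, 0 < c &
        forall x, Num.max (p i x) (p j x) <= c * p k x
    & forall U, nbhs (0 : E) U <->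
        exists i, exists2 e : R, 0 < e & [set x | p i x < e] `<=` U].

Definition lc_bounded D : Prop :=
  forall U, nbhs (0 : E) U -> exists2 r : R, 0 < r & D `<=` rscale r @` U.

Definition absolutely_convex D : Prop :=
  D !=set0 /\
  forall (a b : Cplx R) x y, cabs a + cabs b <= 1 -> D x -> D y ->
    D (a *: x + b *: y).

Definition disk D : Prop := lc_bounded D /\ absolutely_convex D.

Definition disk_span D : set E := \bigcup_n (rscale n%:R @` D).

Definition gauge D x : R :=
  inf [set t : R | 0 < t /\ (rscale t @` D) x].

(* For a disk D in a Hausdorff space the gauge is always a norm on the
   subspace disk_span D, so being Banach amounts to sequential completeness. *)
Definition disk_span_banach D : Prop :=
  forall u : nat -> E, (forall n, disk_span D (u n)) ->
    (forall e : R, 0 < e -> exists N, forall m n, (N <= m)%N -> (N <= n)%N ->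
       gauge D (u m - u n) < e) ->
    exists2 l, disk_span D l & (fun n => gauge D (u n - l)) @ \oo --> (0 : R).

Definition locally_complete : Prop :=
  forall D, disk D -> closed D -> disk_span_banach D.

(* The uniform structure carried by a tvsType is only required to induce the
   topology, not to be translation invariant, so Cauchy filters are defined
   from the neighbourhoods of 0 rather than with the library's cauchy. *)
Definition lc_cauchy (F : set_system E) : Prop :=
  forall U, nbhs (0 : E) U ->
    exists2 A, F A & forall x y, A x -> A y -> U (x - y).

Definition lc_complete : Prop :=
  forall F : set_system E, ProperFilter F -> lc_cauchy F -> exists l : E, F --> l.

End LocallyConvex.

(* A completion is taken up to isomorphism: a complete Hausdorff space together
   with a linear topological embedding of E onto a dense subspace. *)
Definition is_completion (R : realType) (E Ehat : tvsType (Cplx R))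
    (j : {linear E -> Ehat}) : Prop :=
  [/\ hausdorff_space Ehat, lc_complete Ehat,
      (forall U : set E, nbhs (0 : E) U <->
        exists2 V : set Ehat, nbhs (0 : Ehat) V & j @^-1` V `<=` U)
    & dense (range j)].

(* Complex derivative of f : C^d -> E with values in the completion Ehat. *)
Definition is_cderivative (R : realType) (E Ehat : tvsType (Cplx R))
    (j : {linear E -> Ehat}) (d : nat) (f : 'rV[Cplx R]_d -> E)
    (z : 'rV[Cplx R]_d) (L : {linear 'rV[Cplx R]_d -> Ehat}) : Prop :=
  (fun w => rscale (enorm (w - z))^-1 (j (f w) - j (f z) - L (w - z)))
    @ z^' --> (0 : Ehat).

Definition holomorphic (R : realType) (E Ehat : tvsType (Cplx R))
    (j : {linear E -> Ehat}) (d : nat) (f : 'rV[Cplx R]_d -> E) : Prop :=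
  exists df : 'rV[Cplx R]_d -> {linear 'rV[Cplx R]_d -> Ehat},
    (forall z, is_cderivative j f z (df z)) /\
    (forall v, continuous (fun z => df z v)).

(* A multi-index of length at most k has all its entries at most k, so those
   multi-indices are enumerated inside {ffun 'I_d -> 'I_k.+1}. *)
Definition is_polynomial (R : realType) (E : tvsType (Cplx R)) (d k : nat)
    (f : 'rV[Cplx R]_d -> E) : Prop :=
  exists a : {ffun 'I_d -> 'I_k.+1} -> E, forall z,
    f z = \sum_(b : {ffun 'I_d -> 'I_k.+1} | (\sum_j b j <= k)%N)
            (\prod_j z ord0 j ^+ b j) *: a b.

(* Main.v *)
Require Import Defs.
From mathcomp Require Import qpoly ring lra.
Set Implicit Arguments.
Unset Strict Implicit.
Unset Printing Implicit Defensive.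
Import Order.TTheory GRing.Theory Num.Theory.
Local Open Scope classical_set_scope.
Local Open Scope ring_scope.

(** The substantial implication is a Liouville theorem with values in E. It is
proved one seminorm [p] and one complex line at a time.

Restricted to a line, [f] is a function [g] of one complex variable whose
derivative, with values in the completion, is continuous. By a mean value
inequality, near each point [g] is affine up to an error that is Lipschitz
with a small constant, as measured by [p]
([strictly_differentiable_of_derivative]). Density of E in its completion
allows the slope of the affine map to be taken in E, so that the completion
can be left behind here.

Next comes a Cauchy formula in which the integral over the circle of radius
[rho] is replaced by the mean over the points [w_j = rho * omega ^ j], where
[omega] is a primitive [N]-th root of unity: up to an arbitrarily small error
for [p], the value [g z] is the mean of the [g (w_j)] weighted by
[sum_(m < N) (z / w_j) ^ m] ([discrete_cauchy_formula]). As in the usual proof,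
the circle is contracted to [z] by [s |-> z + s (w_j - z)]. The derivative in
[s] of the weighted mean is a multiple of [sum_j w_j g'(z + s (w_j - z))], which
is a Riemann sum for the integral of [g'] along a closed curve, hence small.

If [p (g w) = O(|w| ^ k)], the terms with [m > k] of the weights contribute
[O(1 / rho)]. Thus [g] is, on every disc and up to any error for [p], a
polynomial of degree at most [k] with coefficients in E
([growth_polynomial_approximation]). Lagrange interpolation at [0, ..., k]
reproduces such polynomials, so [g] agrees with its own interpolant up to a
vector on which [p] vanishes ([polynomial_growth_interpolant]). Every seminorm of
the system vanishes on that vector, and E is Hausdorff: [g] equals its
interpolant, whose coefficients are combinations of values of [g].

It remains to recover [f] from its restrictions to lines. Interpolating in one
coordinate after the other gives finitely many monomials
([finite_polynomial_of_lines]); those of total degree above [k] cancel because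
[t |-> f (t z)] has degree at most [k] ([total_degree_truncation]). *)

(** * Vector-valued Lagrange interpolation *)

(** The nodes [0, ..., k] are distinct because a [numFieldType] has
characteristic 0. *)
Definition lagrange_nat (K : numFieldType) (k : nat) (i : 'I_k.+1) : {poly K} :=
  tnth (lagrange k.+1 (fun n => n%:R)) i.

Definition interpolant (K : numFieldType) (E : lmodType K) (k : nat)
    (g : K -> E) (t : K) : E :=
  \sum_(i < k.+1) (lagrange_nat K i).[t] *: g i%:R.

Lemma lagrange_nat_monomial (K : numFieldType) (k m : nat) : (m <= k)%N ->
  \sum_(i < k.+1) (i%:R ^+ m)%:P * lagrange_nat K i = 'X^m.
Proof.
move=> mk; have natr_inj : injective (fun n : nat => n%:R : K).
  by move=> a b /eqP; rewrite eqr_nat => /eqP.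
have szX : (size ('X^m : {poly K}) <= k.+1)%N by rewrite size_polyXn.
rewrite [RHS](lagrange_gen (ltn0Sn k) natr_inj szX).
by apply: eq_bigr => i _; rewrite hornerXn.
Qed.

Lemma interpolant_cst (K : numFieldType) (E : lmodType K) (k : nat) (c : E)
    (t : K) : interpolant k (fun=> c) t = c.
Proof.
rewrite /interpolant -scaler_suml -horner_sum.
have := lagrange_nat_monomial K (leq0n k).
under eq_bigr => i _ do rewrite expr0 mul1r.
by move=> ->; rewrite hornerE scale1r.
Qed.

Lemma interpolant_polynomial (K : numFieldType) (E : lmodType K) (k : nat)
    (b : nat -> E) (t : K) :
  interpolant k (fun s => \sum_(m < k.+1) s ^+ m *: b m) t =
  \sum_(m < k.+1) t ^+ m *: b m.
Proof.
rewrite /interpolant.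
under eq_bigr => i _ do rewrite scaler_sumr.
rewrite exchange_big /=; apply: eq_bigr => m _.
under eq_bigr => i _ do rewrite scalerA.
rewrite -scaler_suml; congr (_ *: _).
rewrite -(hornerXn t m) -(@lagrange_nat_monomial K k m); last by rewrite -ltnS.
by rewrite horner_sum; apply: eq_bigr => i _; rewrite hornerM hornerC mulrC.
Qed.

Lemma interpolant_powers (K : numFieldType) (E : lmodType K) (k : nat)
    (g : K -> E) (t : K) :
  interpolant k g t =
  \sum_(m < k.+1) t ^+ m *: (\sum_(i < k.+1) (lagrange_nat K i)`_m *: g i%:R).
Proof.
rewrite /interpolant.
under [RHS]eq_bigr => m _ do rewrite scaler_sumr.
rewrite exchange_big /=; apply: eq_bigr => i _.
under eq_bigr => m _ do rewrite scalerA.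
rewrite -scaler_suml; congr (_ *: _).
have sz : size (lagrange_nat K i) = k.+1.
  apply: size_lagrange_ => // a b /eqP.
  by rewrite eqr_nat => /eqP.
by rewrite horner_coef sz; apply: eq_bigr => m _; rewrite mulrC.
Qed.

(** Each [b m] is a combination of the values at [0, ..., n - 1], with the
coefficients of [t ^ m] in the Lagrange polynomials as weights. *)
Lemma vector_polynomial_eq0 (K : numFieldType) (E : lmodType K) (n : nat)
    (b : nat -> E) :
  (forall t : K, \sum_(m < n) t ^+ m *: b m = 0) ->
  forall m, (m < n)%N -> b m = 0.
Proof.
case: n => [//|n] b0 l ln.
have : \sum_(i < n.+1) (lagrange_nat K i)`_l *:
    (\sum_(m < n.+1) (i%:R : K) ^+ m *: b m) = 0.
  by rewrite big1 // => i _; rewrite b0 scaler0.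
under eq_bigr => i _ do rewrite scaler_sumr.
rewrite exchange_big /=.
have coef_extract (m : 'I_n.+1) : \sum_(i < n.+1) (lagrange_nat K i)`_l *:
    ((i%:R : K) ^+ m *: b m) = (l == m)%:R *: b m.
  under eq_bigr => i _ do rewrite scalerA mulrC -coefCM.
  rewrite -scaler_suml; congr (_ *: _).
  have mn : (m <= n)%N by rewrite -ltnS.
  by rewrite -[RHS]coefXn -(lagrange_nat_monomial K mn) coef_sum.
under eq_bigr => m _ do rewrite coef_extract.
rewrite (bigD1 (Ordinal ln)) //= eqxx scale1r big1 ?addr0 // => m.
by rewrite -val_eqE eq_sym /= => /negPf ->; rewrite scale0r.
Qed.

(** * From lines to polynomials in several variables *)

Definition monomial (K : numFieldType) (d : nat) (b : 'I_d -> nat)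
    (z : 'rV[K]_d) : K := \prod_j z ord0 j ^+ b j.

(** Exponents are left unbounded here, so that the property is stable under
multiplication by powers of a coordinate. *)
Definition finite_polynomial (K : numFieldType) (E : lmodType K) (d : nat)
    (F : 'rV[K]_d -> E) : Prop :=
  exists s : seq (('I_d -> nat) * E),
    forall z, F z = \sum_(q <- s) monomial q.1 z *: q.2.

Lemma finite_polynomial_sum (K : numFieldType) (E : lmodType K) (d : nat)
    (T : Type) (r : seq T) (F : T -> 'rV[K]_d -> E) :
  (forall i, finite_polynomial (F i)) ->
  finite_polynomial (fun z => \sum_(i <- r) F i z).
Proof.
move=> FP; elim: r => [|i r [s sE]].
  by exists [::] => z; rewrite !big_nil.
have [s' s'E] := FP i; exists (s' ++ s) => z.
by rewrite big_cons big_cat /= s'E sE.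
Qed.

Lemma finite_polynomialZ (K : numFieldType) (E : lmodType K) (d : nat)
    (j : 'I_d) (m : nat) (c : K) (F : 'rV[K]_d -> E) : finite_polynomial F ->
  finite_polynomial (fun z => (c * z ord0 j ^+ m) *: F z).
Proof.
move=> [s sE].
exists [seq ((fun i => q.1 i + m * (i == j))%N, c *: q.2) | q <- s] => z.
rewrite sE big_map scaler_sumr; apply: eq_bigr => q _ /=.
rewrite !scalerA; congr (_ *: _).
rewrite mulrC [RHS]mulrC mulrCA; congr (_ * _).
under [RHS]eq_bigr => i _ do rewrite exprD.
rewrite big_split /=; congr (_ * _).
rewrite (bigD1 j) //= eqxx muln1 big1 ?mulr1 // => i /negPf ->.
by rewrite muln0 expr0.
Qed.

(** The coordinates are moved away from [a] one at a time: along the line in the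
direction of the [j]-th basis vector, interpolation expresses the value as a
combination, polynomial in [z_j], of values based at the shifted points
[a + i e_j], to which the induction hypothesis applies. *)
Lemma finite_polynomial_of_lines (K : numFieldType) (E : lmodType K)
    (d k : nat) (f : 'rV[K]_d -> E) :
  (forall a v t,
    f (a + t *: v) = interpolant k (fun s => f (a + s *: v)) t) ->
  finite_polynomial f.
Proof.
move=> f_line.
suff P (s : seq 'I_d) a :
    finite_polynomial (fun z => f (a + \sum_(j <- s) z ord0 j *: delta_mx 0 j)).
  have [s sE] := P (index_enum 'I_d) 0; exists s => z.
  by rewrite -sE add0r -row_sum_delta.
elim: s a => [|j s IH] a.
  exists [:: (fun=> 0%N, f a)] => z.
  by rewrite big_nil addr0 big_seq1 /monomial big1 ?scale1r.
pose h (i : 'I_k.+1) (z : 'rV[K]_d) :=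
  f (a + i%:R *: delta_mx 0 j + \sum_(j <- s) z ord0 j *: delta_mx 0 j).
have -> : (fun z : 'rV[K]_d => f (a + \sum_(l <- j :: s) z ord0 l *: delta_mx 0 l)) =
    (fun z : 'rV[K]_d => \sum_(m < k.+1) \sum_(i < k.+1)
       ((lagrange_nat K i)`_m * z ord0 j ^+ m) *: h i z).
  apply/funext => z.
  rewrite big_cons addrCA addrC f_line interpolant_powers.
  apply: eq_bigr => m _; rewrite scaler_sumr; apply: eq_bigr => i _.
  by rewrite scalerA mulrC /h addrAC.
apply: finite_polynomial_sum => m; apply: finite_polynomial_sum => i.
by apply: finite_polynomialZ; apply: IH.
Qed.

(** Along the ray through [z] the monomials of total degree [m] give the
coefficient of [t ^ m]. Since the ray restriction also has degree at most [k],
uniqueness of coefficients kills the homogeneous parts of degree above [k]. *)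
Lemma total_degree_truncation (K : numFieldType) (E : lmodType K)
    (d k : nat) (f : 'rV[K]_d -> E) (s : seq (('I_d -> nat) * E)) :
  (forall z, f z = \sum_(q <- s) monomial q.1 z *: q.2) ->
  (forall z t, f (t *: z) = interpolant k (fun u => f (u *: z)) t) ->
  forall z, f z =
    \sum_(q <- s | (\sum_j q.1 j <= k)%N) monomial q.1 z *: q.2.
Proof.
move=> fE f_line z.
pose deg (q : ('I_d -> nat) * E) := (\sum_j q.1 j)%N.
pose B m := \sum_(q <- s | deg q == m) monomial q.1 z *: q.2.
pose c m := \sum_(i < k.+1) (lagrange_nat K i)`_m *: f (i%:R *: z).
pose c' m := if (m <= k)%N then c m else 0.
(* Large enough for all monomials of [f] and for degree [k]. *)
pose n := (maxn (\max_(q <- s) deg q) k).+1.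
have degn q : q \in s -> (deg q < n)%N.
  by move=> qs; rewrite ltnS leq_max leq_bigmax_seq.
have homogeneous t : f (t *: z) = \sum_(m < n) t ^+ m *: B m.
  have -> : f (t *: z) = \sum_(q <- s) t ^+ deg q *: (monomial q.1 z *: q.2).
    rewrite fE; apply: eq_bigr => q _; rewrite scalerA; congr (_ *: _).
    rewrite /monomial /deg -prodrXr -big_split /=.
    by apply: eq_bigr => i _; rewrite mxE exprMn.
  under [RHS]eq_bigr => m _ do rewrite scaler_sumr.
  rewrite (exchange_big_dep predT) //= big_seq [RHS]big_seq.
  apply: eq_bigr => q qs; rewrite (big_pred1 (Ordinal (degn _ qs))) //.
have low t : f (t *: z) = \sum_(m < n) t ^+ m *: c' m.
  rewrite f_line interpolant_powers (big_ord_widen n (fun m => t ^+ m *: c m)).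
    by rewrite big_mkcond /=; apply: eq_bigr => m _; rewrite /c' ltnS;
      case: ifP => // _; rewrite scaler0.
  by rewrite ltnS leq_maxr.
have Bc m : (m < n)%N -> B m - c' m = 0.
  apply: (@vector_polynomial_eq0 _ _ n (fun m => B m - c' m)) => t.
  under eq_bigr => i _ do rewrite scalerBr.
  by rewrite big_split /= sumrN -homogeneous -low subrr.
have B0 m : (k < m)%N -> B m = 0.
  move=> km; case: (ltnP m n) => mn.
    by have := Bc _ mn; rewrite /c' leqNgt km subr0.
  rewrite /B big_seq_cond big_pred0 // => q; apply/negP => /andP[/degn qn /eqP qm].
  by rewrite qm ltnNge mn in qn.
have fz : f z = \sum_(m < n) B m.
  by rewrite -[z]scale1r homogeneous; apply: eq_bigr => m _;
    rewrite expr1n scale1r.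
rewrite fz (bigID (fun m : 'I_n => (m <= k)%N)) /= [X in _ + X]big1 ?addr0; last first.
  by move=> m; rewrite -ltnNge => /B0.
rewrite (exchange_big_dep (fun q => (deg q <= k)%N)) /=; last first.
  by move=> m q mk /eqP ->.
rewrite big_seq_cond [RHS]big_seq_cond; apply: eq_bigr => q /andP[qs qk].
rewrite (big_pred1 (Ordinal (degn _ qs))) // => m /=.
rewrite -val_eqE /= andbC eq_sym; case: (eqVneq (m : nat) (deg q)) => //= ->.
exact: qk.
Qed.

Lemma is_polynomial_of_lines (R : realType) (E : tvsType (Cplx R))
    (d k : nat) (f : 'rV[Cplx R]_d -> E) :
  (forall a v t,
    f (a + t *: v) = interpolant k (fun s => f (a + s *: v)) t) ->
  is_polynomial k f.
Proof.
move=> f_line; have [s sE] := finite_polynomial_of_lines f_line.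
have f_ray z t : f (t *: z) = interpolant k (fun u => f (u *: z)) t.
  rewrite -[t *: z]add0r f_line; congr (interpolant k _ t).
  by apply/funext => u; rewrite add0r.
exists (fun b : {ffun 'I_d -> 'I_k.+1} => \sum_(q <- s |
  (\sum_j q.1 j <= k)%N && [forall j, q.1 j == b j :> nat]) q.2) => z.
rewrite (total_degree_truncation sE f_ray).
under [RHS]eq_bigr => b _ do rewrite scaler_sumr.
rewrite (exchange_big_dep (fun q => \sum_j q.1 j <= k)%N) /=; last first.
  by move=> b q _ /andP[].
apply: eq_bigr => q qk.
have qle i : (q.1 i < k.+1)%N.
  by rewrite ltnS; apply: leq_trans qk; rewrite (bigD1 i) //= leq_addr.
rewrite (big_pred1 [ffun i => Ordinal (qle i)]); last first.
  move=> b; rewrite qk /=; apply/andP/eqP => [[_ /forallP qb]|->].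
    by apply/ffunP => i; rewrite ffunE; apply/val_inj; rewrite /= (eqP (qb i)).
  split; last by apply/forallP => i; rewrite ffunE.
  by under eq_bigr => i _ do rewrite ffunE /=.
by congr (_ *: _); apply: eq_bigr => i _; rewrite ffunE.
Qed.

(** * The modulus, the Euclidean norm and seminorms *)

Section Modulus.
Context (R : realType).
Implicit Types a b : Cplx R.

Lemma cabsE a : (cabs a)%:C%C = `|a| :> R[i].
Proof. by rewrite /cabs; case: a => x y; rewrite /Num.norm /=. Qed.

Lemma ltc_cabs a (e : R) : (`|a| < (e%:C%C : Cplx R)) = (cabs a < e).
Proof. by rewrite -cabsE ltcR. Qed.

Lemma cabs_ge0 a : 0 <= cabs a.
Proof. by rewrite -lecR cabsE normr_ge0. Qed.

Lemma cabsM a b : cabs (a * b) = cabs a * cabs b.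
Proof. by apply/complexI; rewrite rmorphM /= !cabsE normrM. Qed.

Lemma cabsX a n : cabs (a ^+ n) = cabs a ^+ n.
Proof. by apply/complexI; rewrite rmorphXn /= !cabsE normrX. Qed.

Lemma cabsV a : cabs a^-1 = (cabs a)^-1.
Proof. by apply/complexI; rewrite fmorphV /= !cabsE normfV. Qed.

Lemma cabsD a b : cabs (a + b) <= cabs a + cabs b.
Proof. by rewrite -lecR rmorphD /= !cabsE ler_normD. Qed.

Lemma cabsN a : cabs (- a) = cabs a.
Proof. by rewrite /cabs normrN. Qed.

Lemma cabsB a b : cabs (a - b) <= cabs a + cabs b.
Proof. by rewrite -(cabsN b) cabsD. Qed.

Lemma cabs_eq0 a : (cabs a == 0) = (a == 0).
Proof. by rewrite -(inj_eq (@complexI R)) cabsE normr_eq0. Qed.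

Lemma cabs_gt0 a : (0 < cabs a) = (a != 0).
Proof. by rewrite lt_neqAle cabs_ge0 andbT eq_sym cabs_eq0. Qed.

Lemma cabs0 : cabs (0 : Cplx R) = 0.
Proof. by apply/eqP; rewrite cabs_eq0. Qed.

Lemma cabs1 : cabs (1 : Cplx R) = 1.
Proof. by rewrite /cabs normr1. Qed.

Lemma cabs_real (t : R) : cabs (t%:C%C : Cplx R) = `|t|.
Proof. by rewrite /cabs normc_def /= expr0n addr0 sqrtr_sqr. Qed.

Lemma cabs_nat n : cabs (n%:R : Cplx R) = n%:R.
Proof.
by rewrite -[RHS]ger0_norm // -cabs_real rmorph_nat.
Qed.

Lemma cabs_complex_le (x y : R) : cabs (x +i* y)%C <= `|x| + `|y|.
Proof.
rewrite /cabs normc_def /= -[leRHS]ger0_norm ?addr_ge0 // -sqrtr_sqr.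
apply: ler_wsqrtr; rewrite sqrrD !real_normK ?num_real // lerD2r lerDl.
by rewrite mulrn_wge0 // mulr_ge0.
Qed.

Lemma cabs_sum (T : Type) (r : seq T) (P : pred T) (F : T -> Cplx R) :
  cabs (\sum_(i <- r | P i) F i) <= \sum_(i <- r | P i) cabs (F i).
Proof.
elim/big_ind2 : _ => [|a x b y ax yb|//]; first by rewrite cabs0.
exact: le_trans (cabsD _ _) (lerD ax yb).
Qed.

End Modulus.

Section Euclidean.
Context (R : realType) (d : nat).
Implicit Types z v : 'rV[Cplx R]_d.

Lemma enorm_ge0 z : 0 <= enorm z.
Proof. exact: sqrtr_ge0. Qed.

Lemma enormZ (c : Cplx R) z : enorm (c *: z) = cabs c * enorm z.
Proof.
rewrite /enorm -[cabs c]ger0_norm ?cabs_ge0 // -sqrtr_sqr -sqrtrM ?sqr_ge0 //.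
congr Num.sqrt; rewrite mulr_sumr; apply: eq_bigr => i _.
by rewrite mxE cabsM exprMn.
Qed.

Lemma cabs_le_enorm z i : cabs (z ord0 i) <= enorm z.
Proof.
rewrite /enorm -[leLHS]ger0_norm ?cabs_ge0 // -sqrtr_sqr ler_wsqrtr //.
by rewrite (bigD1 i) //= lerDl sumr_ge0 // => m _; rewrite sqr_ge0.
Qed.

Lemma enorm_le_sum z : enorm z <= \sum_i cabs (z ord0 i).
Proof.
have sum_ge0 : 0 <= \sum_i cabs (z ord0 i).
  by apply: sumr_ge0 => i _; exact: cabs_ge0.
rewrite /enorm -[leRHS]ger0_norm // -sqrtr_sqr ler_wsqrtr //.
rewrite expr2 mulr_suml; apply: ler_sum => i _; rewrite expr2.
apply: ler_wpM2l; first exact: cabs_ge0.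
by rewrite (bigD1 i) //= lerDl sumr_ge0 // => m _; exact: cabs_ge0.
Qed.

Lemma enorm_gt0 z : (0 < enorm z) = (z != 0).
Proof.
apply/idP/idP => [|z0].
  apply: contraTneq => ->.
  by rewrite -(scale0r (0 : 'rV[Cplx R]_d)) enormZ cabs0 mul0r ltxx.
have [i zi] : exists i, z ord0 i != 0.
  apply/not_existsP => z_eq0; case/negP: z0; apply/eqP/rowP => i.
  by rewrite mxE; have /negP := z_eq0 i; rewrite negbK => /eqP.
by apply: lt_le_trans (cabs_le_enorm z i); rewrite cabs_gt0.
Qed.

(** Along a nonconstant line [enorm (a + t v)] is comparable with [|t|] for
large [t]: a nonzero coordinate of [v] bounds it from below. *)
Lemma line_growth (h : 'rV[Cplx R]_d -> R) (C r : R) (k : nat) (a v : 'rV[Cplx R]_d) :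
  0 < C -> v != 0 ->
  (forall z, r <= enorm z -> h z <= C * enorm z ^+ k) ->
  exists C' r', 0 < C' /\
    forall t : Cplx R, r' <= cabs t -> h (a + t *: v) <= C' * cabs t ^+ k.
Proof.
move=> C0 v0 h_growth.
pose Sa := \sum_i cabs (a ord0 i); pose Sv := \sum_i cabs (v ord0 i).
have Sa0 : 0 <= Sa by apply: sumr_ge0 => i _; exact: cabs_ge0.
have Sv0 : 0 <= Sv by apply: sumr_ge0 => i _; exact: cabs_ge0.
have [i vi] : exists i, v ord0 i != 0.
  apply/not_existsP => v_eq0; case/negP: v0; apply/eqP/rowP => i.
  by rewrite mxE; have /negP := v_eq0 i; rewrite negbK => /eqP.
have cvi : 0 < cabs (v ord0 i) by rewrite cabs_gt0.
have B0 : 0 < Sa + Sv + 1 by lra.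
exists (C * (Sa + Sv + 1) ^+ k), (1 + (`|r| + Sa) / cabs (v ord0 i)).
split=> [|t t_large]; first by rewrite mulr_gt0 // exprn_gt0.
have quot_ge0 : 0 <= (`|r| + Sa) / cabs (v ord0 i).
  by rewrite divr_ge0 ?cabs_ge0 // addr_ge0.
have t1 : 1 <= cabs t by lra.
have ub : enorm (a + t *: v) <= (Sa + Sv + 1) * cabs t.
  apply: le_trans (enorm_le_sum _) _.
  apply: le_trans (_ : Sa + cabs t * Sv <= _); last first.
    have := ler_wpM2l Sa0 t1; nra.
  rewrite mulr_sumr -big_split /=; apply: ler_sum => m _.
  by rewrite !mxE -cabsM; exact: cabsD.
have lb : r <= enorm (a + t *: v).
  apply: le_trans (cabs_le_enorm _ i); rewrite !mxE.
  have : (`|r| + Sa) / cabs (v ord0 i) <= cabs t by lra.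
  rewrite ler_pdivrMr // -cabsM => tv.
  have ai : cabs (a ord0 i) <= Sa.
    by rewrite /Sa (bigD1 i) //= lerDl sumr_ge0 // => m _; exact: cabs_ge0.
  have := cabsB (a ord0 i + t * v ord0 i) (a ord0 i).
  rewrite addrAC subrr add0r; have := ler_norm r; lra.
apply: le_trans (h_growth _ lb) _.
rewrite -mulrA -exprMn ler_pM2l // lerXn2r // nnegrE ?enorm_ge0 //.
by rewrite mulr_ge0 ?cabs_ge0 // ltW.
Qed.

End Euclidean.

Section Seminorm.
Context (R : realType) (E : tvsType (Cplx R)) (p : E -> R)
  (p_semi : is_seminorm p).
Implicit Types (x y : E).

Lemma seminorm_ge0 x : 0 <= p x. Proof. by case: p_semi. Qed.

Lemma seminormD x y : p (x + y) <= p x + p y. Proof. by case: p_semi. Qed.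

Lemma seminormZ (a : Cplx R) x : p (a *: x) = cabs a * p x.
Proof. by case: p_semi. Qed.

Lemma seminorm0 : p 0 = 0.
Proof. by rewrite -(scale0r (0 : E)) seminormZ cabs0 mul0r. Qed.

Lemma seminormN x : p (- x) = p x.
Proof. by rewrite -scaleN1r seminormZ cabsN cabs1 mul1r. Qed.

Lemma seminormB x y : p (x - y) <= p x + p y.
Proof. by rewrite -(seminormN y) seminormD. Qed.

Lemma seminorm_sum (T : Type) (r : seq T) (P : pred T) (F : T -> E) :
  p (\sum_(i <- r | P i) F i) <= \sum_(i <- r | P i) p (F i).
Proof.
elim/big_ind2 : _ => [|a x b y ax yb|//]; first by rewrite seminorm0.
exact: le_trans (seminormD _ _) (lerD ax yb).
Qed.

Lemma seminorm_sum_le (n : nat) (F : 'I_n -> E) (c : R) :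
  (forall i, p (F i) <= c) -> p (\sum_i F i) <= n%:R * c.
Proof.
move=> Fc; apply: le_trans (seminorm_sum _ _ _) _.
by rewrite -[n in n%:R]card_ord mulr_natl -sumr_const ler_sum.
Qed.

(** A continuity argument: the times [t] with [p (u t - u 0) <= K t] have a
supremum; the hypothesis at that supremum shows first that it is such a time and
then that it cannot be smaller than 1. *)
Lemma mean_value_inequality (u : R -> E) (K : R) :
  (forall t, 0 <= t <= 1 -> exists2 eta : R, 0 < eta &
     forall t', 0 <= t' <= 1 -> `|t' - t| < eta ->
       p (u t' - u t) <= K * `|t' - t|) ->
  p (u 1 - u 0) <= K.
Proof.
move=> u_loc.
pose S := [set t : R | 0 <= t <= 1 /\ p (u t - u 0) <= K * t].
have S0 : S 0 by split; rewrite ?lexx ?ler01 // subrr seminorm0 mulr0.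
have S1 : ubound S 1 by move=> t [/andP[_ ->]].
have hS : has_sup S by split; [exists 0|exists 1].
pose s := sup S.
have s0 : 0 <= s by apply: ub_le_sup => //; exists 1.
have s1 : s <= 1 by apply: ge_sup => //; exists 0.
have [eta eta0 near_s] := u_loc s ltac:(by rewrite s0 s1).
have Ss : S s.
  have [t [t01 pt] st] := sup_adherent eta0 hS.
  rewrite -/s in st.
  have ts : t <= s by apply: ub_le_sup => //; exists 1.
  split; first by rewrite s0 s1.
  have := near_s t t01; rewrite ler0_norm ?subr_le0 // => /(_ ltac:(lra)) pst.
  have -> : u s - u 0 = (u t - u 0) - (u t - u s).
    by rewrite opprB [RHS]addrC subrKA.
  apply: le_trans (seminormB _ _) _; apply: le_trans (lerD pt pst) _; lra.
suff s_eq1 : s = 1 by case: Ss => _; rewrite s_eq1 mulr1.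
apply/eqP; rewrite eq_le s1 leNgt; apply/negP => s_lt1.
pose t := s + Num.min (eta / 2) (1 - s).
have min_gt0 : 0 < Num.min (eta / 2) (1 - s).
  by rewrite lt_min divr_gt0 //= subr_gt0.
have min_le1 : Num.min (eta / 2) (1 - s) <= 1 - s by rewrite ge_min lexx orbT.
have min_le2 : Num.min (eta / 2) (1 - s) <= eta / 2 by rewrite ge_min lexx.
have t01 : 0 <= t <= 1 by rewrite /t; apply/andP; split; lra.
have st : s < t by rewrite ltrDl.
have := near_s t t01; rewrite gtr0_norm ?subr_gt0 // => /(_ ltac:(rewrite /t; lra)) pst.
suff : t <= s by rewrite leNgt st.
apply: ub_le_sup; first by exists 1.
split=> //; have -> : u t - u 0 = (u t - u s) + (u s - u 0) by rewrite subrKA.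
case: Ss => _ ps; apply: le_trans (seminormD _ _) _.
by apply: le_trans (lerD pst ps) _; lra.
Qed.

End Seminorm.

(** * Strict differentiability *)

(** The slope [A] lies in E even when the derivative lies in the completion only;
that is why it depends on the tolerance [e]. *)
Definition affine_up_to (R : realType) (E : tvsType (Cplx R)) (p : E -> R)
    (g : Cplx R -> E) (e delta : R) (zeta : Cplx R) (A : E) : Prop :=
  forall w w', cabs (w - zeta) < delta -> cabs (w' - zeta) < delta ->
    p (g w - g w' - (w - w') *: A) <= e * cabs (w - w').

Definition strictly_differentiable (R : realType) (E : tvsType (Cplx R))
    (p : E -> R) (g : Cplx R -> E) : Prop :=
  forall zeta (e : R), 0 < e ->
    exists A, exists2 delta : R, 0 < delta & affine_up_to p g e delta zeta A.

(** Compactness of the square containing the disc: the radius [delta] for a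
centre [zeta] also works, once halved, for all centres near [zeta]. *)
Lemma uniform_strict_differentiability (R : realType) (E : tvsType (Cplx R))
    (p : E -> R) (g : Cplx R -> E) (e rho : R) :
  strictly_differentiable p g -> 0 < e ->
  exists2 delta : R, 0 < delta &
    forall zeta, cabs zeta <= rho -> exists A, affine_up_to p g e delta zeta A.
Proof.
move=> g_sd e0.
pose toC (v : R * R) : Cplx R := (v.1 +i* v.2)%C.
have toCB v v' : cabs (toC v - toC v') <= `|v.1 - v'.1| + `|v.2 - v'.2|.
  have -> : toC v - toC v' = ((v.1 - v'.1) +i* (v.2 - v'.2))%C.
    by rewrite /toC; simpc.
  exact: cabs_complex_le.
have K_compact : compact (`[- rho, rho] `*` `[- rho, rho] : set (R * R)).
  by apply: compact_setX; apply: segment_compact.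
pose P delta v := exists A, affine_up_to p g e delta (toC v) A.
have : \forall delta \near (0 : R)^'+,
    (`[- rho, rho] `*` `[- rho, rho] : set (R * R)) `<=` P delta.
  move: K_compact => /compact_near_coveringP; apply => v _.
  have [A [d0 d0_gt0 gA]] := g_sd (toC v) e e0.
  exists (ball v (d0 / 4), [set d | d < d0 / 2]) => /=.
    split; first by apply: nbhsx_ballx; rewrite divr_gt0.
    by apply: nbhs_right_lt; rewrite divr_gt0.
  move=> [v' d] /= [vv' dd0]; exists A => w w' wv' w'v'.
  have toCv : cabs (toC v' - toC v) < d0 / 2.
    case: vv' => b1 b2; apply: le_lt_trans (toCB _ _) _.
    rewrite /ball /= in b1 b2.
    by rewrite distrC [X in _ + X]distrC; lra.
  have close (x : Cplx R) : cabs (x - toC v') < d -> cabs (x - toC v) < d0.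
    move=> xd; rewrite -(subrKA (toC v')).
    by apply: le_lt_trans (cabsD _ _) _; lra.
  by apply: gA; exact: close.
move=> H; have [delta [delta0 covered]] :
    exists d : R, 0 < d /\
      (`[- rho, rho] `*` `[- rho, rho] : set (R * R)) `<=` P d.
  have /filter_ex[d [d0 Hd]] :
    \forall d \near (0 : R)^'+, 0 < d /\
      (`[- rho, rho] `*` `[- rho, rho] : set (R * R)) `<=` P d.
    by apply: filterI => //; apply: nbhs_right_gt.
  by exists d.
exists delta => // zeta zeta_rho.
have -> : zeta = toC (complex.Re zeta, complex.Im zeta) by case: (zeta).
apply: covered; rewrite /= !in_itv /= -!ler_norml.
split; apply: le_trans zeta_rho; rewrite /cabs normc_def /= -sqrtr_sqr.
  by rewrite ler_wsqrtr // lerDl sqr_ge0.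
by rewrite ler_wsqrtr // lerDr sqr_ge0.
Qed.

Lemma nbhs0_half (K : numDomainType) (F : tvsType K) (U : set F) :
  nbhs 0 U -> exists2 V, nbhs 0 V & forall x y, V x -> V y -> U (x + y).
Proof.
have := @add_continuous F (0, 0) U; rewrite /= addr0 => /[apply].
move=> [[A B] /= [A0 B0] AB].
exists (A `&` B) => [|x y [Ax _] [_ By]]; first exact: filterI.
exact: (AB (x, y)).
Qed.

Lemma nbhs_translate (K : numDomainType) (F : tvsType K) (U : set F) :
  nbhs 0 U -> forall y, \forall x \near y, U (x - y).
Proof.
move=> U0 y; have := nbhsT y U0; apply: filterS => _ [x Ux <-].
by rewrite /= addrAC subrr add0r.
Qed.

(** Scaling is continuous at [(0, 0)]; the factor [e / 2] leaves room
for scalars of modulus exactly 1. *)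
Lemma nbhs0_balanced (R : realType) (F : tvsType (Cplx R)) (U : set F) :
  nbhs 0 U -> exists2 V, nbhs 0 V &
    forall (u : Cplx R) x, cabs u <= 1 -> V x -> U (u *: x).
Proof.
have := @scale_continuous (Cplx R) F (0, 0) U; rewrite /= scaler0 => /[apply].
move=> [[A B] /= [/nbhs_ballP[e /= e0 eA] B0] AB].
have e2 : e / 2 != 0 by rewrite gt_eqF // divr_gt0.
exists ( *:%R (e / 2) @` B); first exact: nbhs0Z.
move=> u _ u1 [x Bx <-]; rewrite scalerA; apply: (AB (_, x)); split=> //=.
apply: eA; rewrite /ball /= sub0r normrN normrM.
have u1' : `|u| <= 1 by rewrite -cabsE -(rmorph1 (real_complex R)) lecR.
apply: le_lt_trans (ler_wpM2r _ u1') _; first exact: normr_ge0.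
by rewrite mul1r gtr0_norm ?divr_gt0 // ltr_pdivrMr // ltr_pMr // ltr1n.
Qed.

Lemma nbhs_cabsP (R : realType) (z : Cplx R) (P : set (Cplx R)) :
  nbhs z P <-> exists2 e : R, 0 < e & forall w, cabs (w - z) < e -> P w.
Proof.
split=> [/nbhs_ballP[e /= e0 eP]|[e e0 eP]].
  exists (cabs e); first by rewrite cabs_gt0 gt_eqF.
  move=> w wz; apply: eP; rewrite /ball /= distrC.
  by rewrite -[e]gtr0_norm // -[`|e|]cabsE ltc_cabs.
apply/nbhs_ballP; exists (e%:C%C) => /=; first by rewrite ltcR.
by move=> w; rewrite /ball /= distrC ltc_cabs => /eP.
Qed.

(** Near [zeta] the derivative [G] stays close to some [j A], because [G] is
continuous and [j] has dense range. The function [g] minus the linear map of slope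
[A] therefore has small difference quotients at every point near [zeta], and the
mean value inequality on the segment from [w'] to [w] sums them up. *)
Lemma strictly_differentiable_of_derivative (R : realType)
    (E Ehat : tvsType (Cplx R)) (j : {linear E -> Ehat}) (p : E -> R)
    (g : Cplx R -> E) (G : Cplx R -> Ehat) :
  is_seminorm p -> dense (range j) ->
  (forall e : R, 0 < e ->
     exists2 V : set Ehat, nbhs 0 V & forall x, V (j x) -> p x < e) ->
  continuous G ->
  (forall (z : Cplx R) (V : set Ehat), nbhs 0 V ->
     \forall w \near z, w != z ->
     V ((w - z)^-1 *: (j (g w) - j (g z)) - G z)) ->
  strictly_differentiable p g.
Proof.
move=> p_semi j_dense j_emb G_cont g_deriv zeta e e0.
have [V0 V00 V0p] := j_emb e e0.
have [V1 V10 V1D] := nbhs0_half V00.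
have [V2 V20 V2D] := nbhs0_half V10.
have [A GA] : exists A, V2 (G zeta - j A).
  have near_G : nbhs (G zeta) [set y | V2 (G zeta - y)].
    have := nbhs_translate (nbhs0N V20) (G zeta); apply: filterS => y [x Vx xE].
    by rewrite /= -opprB -xE opprK.
  have [y [/interior_subset Vy [A _ Ay]]] := j_dense _
    (ex_intro _ _ (near_G : _^° (G zeta))) (open_interior _).
  by exists A; rewrite Ay.
have : \forall z \near zeta, V2 (G z - G zeta).
  exact: G_cont _ _ (nbhs_translate V20 (G zeta)).
move=> /nbhs_cabsP[delta delta0 G_near]; exists A, delta => // w w' w_near w'_near.
pose gamma (t : R) := w' + t%:C%C * (w - w').
pose u t := g (gamma t) - (t%:C%C * (w - w')) *: A.
have -> : g w - g w' - (w - w') *: A = u 1 - u 0.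
  by rewrite /u /gamma !mul0r scale0r addr0 subr0 !mul1r [w' + _]addrC subrK addrAC.
apply: mean_value_inequality => // t /andP[t0 t1].
have gamma_near : cabs (gamma t - zeta) < delta.
  have -> : gamma t - zeta = (1 - t)%:C%C * (w' - zeta) + t%:C%C * (w - zeta).
    by rewrite /gamma rmorphB rmorph1; ring.
  apply: le_lt_trans (cabsD _ _) _; rewrite !cabsM !cabs_real.
  rewrite !ger0_norm ?subr_ge0 //.
  have [->|t_neq0] := eqVneq t 0; first by rewrite mul0r addr0 subr0 mul1r.
  have t_gt0 : 0 < t by rewrite lt_neqAle eq_sym t_neq0.
  have := ler_wpM2l (_ : 0 <= 1 - t) (ltW w'_near).
  rewrite subr_ge0 => /(_ t1); rewrite -(ltr_pM2l t_gt0) in w_near; lra.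
have : \forall z \near gamma t, z != gamma t ->
    V1 ((z - gamma t)^-1 *: (j (g z) - j (g (gamma t))) - G (gamma t)).
  exact: g_deriv.
move=> /nbhs_cabsP[eta eta0 quotient_near].
have W0 : 0 < cabs (w - w') + 1 by rewrite ltr_wpDl ?cabs_ge0.
exists (eta / (cabs (w - w') + 1)); first by rewrite divr_gt0.
move=> t' _ tt'.
have gammaB : gamma t' - gamma t = (t' - t)%:C%C * (w - w').
  by rewrite /gamma rmorphB; ring.
have gammaB_cabs : cabs (gamma t' - gamma t) = `|t' - t| * cabs (w - w').
  by rewrite gammaB cabsM cabs_real.
have -> : u t' - u t = g (gamma t') - g (gamma t) - (gamma t' - gamma t) *: A.
  rewrite /u gammaB rmorphB mulrBl scalerBl !opprB -!addrA; congr (_ + _).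
  by rewrite addrCA [RHS]addrCA; congr (_ + _); rewrite addrC.
rewrite -mulrA [cabs _ * _]mulrC -gammaB_cabs.
have [->|gamma_neq] := eqVneq (gamma t') (gamma t).
  by rewrite !subrr scale0r subr0 seminorm0 // cabs0 mulr0.
have gB0 : gamma t' - gamma t != 0 by rewrite subr_eq0.
have -> : g (gamma t') - g (gamma t) - (gamma t' - gamma t) *: A =
    (gamma t' - gamma t) *:
      ((gamma t' - gamma t)^-1 *: (g (gamma t') - g (gamma t)) - A).
  by rewrite scalerBr scalerA divff // scale1r.
rewrite seminormZ // mulrC ler_wpM2r ?cabs_ge0 //; apply/ltW/V0p.
rewrite linearB linearZ linearB /= -(subrKA (G (gamma t))); apply: V1D.
  apply: quotient_near => //; rewrite gammaB_cabs.
  rewrite ltr_pdivlMr // in tt'; apply: le_lt_trans tt'.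
  by rewrite ler_wpM2l // lerDl.
by rewrite -(subrKA (G zeta)); apply: V2D => //; apply: G_near.
Qed.

Lemma continuous_line (K : numFieldType) (V : normedModType K) (a v : V) :
  continuous (fun t : K => a + t *: v).
Proof.
move=> t; apply: (@continuousD K V K (fun=> a) (fun t => t *: v)).
  exact: cst_continuous.
exact: scalel_continuous.
Qed.

(** The definition of the derivative divides by the real number
[enorm ((w - z) v) = |w - z| enorm v]. Dividing by [w - z] instead multiplies by a
scalar of modulus [enorm v], which balanced neighbourhoods absorb. *)
Lemma holomorphic_line_derivative (R : realType) (E Ehat : tvsType (Cplx R))
    (j : {linear E -> Ehat}) (d : nat) (f : 'rV[Cplx R]_d -> E)
    (a v : 'rV[Cplx R]_d) : holomorphic j f -> v != 0 ->
  exists2 G : Cplx R -> Ehat, continuous G &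
    forall (z : Cplx R) (V : set Ehat), nbhs 0 V ->
     \forall w \near z, w != z ->
     V ((w - z)^-1 *: (j (f (a + w *: v)) - j (f (a + z *: v))) - G z).
Proof.
move=> [df [df_deriv df_cont]] v0.
have line_cont : continuous (fun t : Cplx R => a + t *: v).
  exact: continuous_line.
exists (fun t => df (a + t *: v) v).
  move=> t; apply: (@cvg_comp _ _ _ (fun t => a + t *: v) (fun z => df z v)).
    exact: line_cont.
  exact: df_cont.
move=> z V V0; have [W W0 WV] := nbhs0_balanced V0.
have ev : 0 < enorm v by rewrite enorm_gt0.
have ev0 : (enorm v)%:C%C != 0 :> Cplx R by rewrite -cabs_gt0 cabs_real normr_gt0 gt_eqF.
have W'0 := nbhs0Z (invr_neq0 ev0) W0.
have := df_deriv (a + z *: v) _ W'0; rewrite /= => near_z.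
have : \forall y \near a + z *: v, y != a + z *: v ->
  ( *:%R (enorm v)%:C%C^-1 @` W) (rscale (enorm (y - (a + z *: v)))^-1
    (j (f y) - j (f (a + z *: v)) - df (a + z *: v) (y - (a + z *: v)))).
  exact: near_z.
move=> /(line_cont z) /nbhs_cabsP[eta eta0 near_line].
apply/nbhs_cabsP; exists eta => // w /near_line Hw wz.
have wz0 : w - z != 0 by rewrite subr_eq0.
have dvec : a + w *: v - (a + z *: v) = (w - z) *: v.
  by rewrite opprD addrACA subrr add0r scalerBl.
have [] := Hw.
  by rewrite -subr_eq0 dvec scaler_eq0 negb_or wz0.
rewrite dvec linearZ enormZ /= => x Wx xE.
have -> : (w - z)^-1 *: (j (f (a + w *: v)) - j (f (a + z *: v))) -
    df (a + z *: v) v = ((cabs (w - z))%:C%C / (w - z)) *: x.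
  have cw0 : (cabs (w - z))%:C%C != 0 :> Cplx R.
    by rewrite cabsE normr_eq0.
  have -> : x = (enorm v)%:C%C *: ((enorm v)%:C%C^-1 *: x).
    by rewrite scalerA divff // scale1r.
  have inv_split : ((cabs (w - z) * enorm v)^-1)%:C%C =
      (cabs (w - z))%:C%C^-1 / (enorm v)%:C%C :> Cplx R.
    by rewrite fmorphV rmorphM invfM.
  rewrite xE /rscale inv_split !scalerA.
  have -> : (cabs (w - z))%:C%C / (w - z) * (enorm v)%:C%C *
      ((cabs (w - z))%:C%C^-1 / (enorm v)%:C%C) = (w - z)^-1 :> Cplx R.
    by field; rewrite wz0 cw0 ev0.
  by rewrite [RHS]scalerBr scalerA mulVf // scale1r.
apply: WV => //; rewrite cabsM cabsV cabs_real ger0_norm ?cabs_ge0 // divff //.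
by rewrite cabs_eq0.
Qed.

(** * A Cauchy formula at roots of unity *)

Definition unit_circle (R : realType) (x : R) : Cplx R := (cos x +i* sin x)%C.

Lemma unit_circleX (R : realType) (x : R) n :
  unit_circle x ^+ n = unit_circle (n%:R * x).
Proof.
elim: n => [|n IH]; first by rewrite expr0 mul0r /unit_circle cos0 sin0.
rewrite exprS IH -natr1 mulrDl mul1r addrC /unit_circle cosD sinD.
by rewrite /GRing.mul /=; congr (_ +i* _)%C; rewrite addrC.
Qed.

Lemma cabs_unit_circle (R : realType) (x : R) : cabs (unit_circle x) = 1.
Proof. by rewrite /cabs normc_def /= cos2Dsin2 sqrtr1. Qed.

(** The witness is [exp (2 i pi / N)] for large [N]. *)
Lemma fine_root_of_unity (R : realType) (eta : R) (n0 : nat) : 0 < eta ->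
  exists N, exists2 omega : Cplx R, N.-primitive_root omega &
    [/\ (n0 < N)%N, cabs omega = 1 & cabs (omega - 1) < eta].
Proof.
move=> eta0.
have : \forall x \near (0 : R), cabs (unit_circle x - 1) < eta.
  have c0 := @continuous_cos R 0; have s0 := @continuous_sin R 0.
  move/cvgrPdist_lt : c0 => /(_ (eta / 2) ltac:(lra)) c0.
  move/cvgrPdist_lt : s0 => /(_ (eta / 2) ltac:(lra)) s0.
  near=> x.
  have -> : unit_circle x - 1 = ((cos x - 1) +i* sin x)%C.
    by rewrite /unit_circle -[1 in LHS](rmorph1 (real_complex R)) /=; simpc.
  apply: le_lt_trans (cabs_complex_le _ _) _.
  have : `|cos 0 - cos x| < eta / 2 by near: x.
  have : `|sin 0 - sin x| < eta / 2 by near: x.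
  rewrite cos0 sin0 sub0r normrN distrC; lra.
move=> /nbhs_ballP[x0 /= x0_gt0 small].

pose n := Num.truncn (2 * pi / x0).
pose N := (maxn n n0).+1.
have N_gt0 : 0 < N%:R :> R by rewrite ltr0n.
have N_neq0 : N%:R != 0 :> R by rewrite gt_eqF.
have pi0 := pi_gt0 R.
exists N, (unit_circle (2 * pi / N%:R)); last first.
  split; [by rewrite ltnS leq_maxr|exact: cabs_unit_circle|apply: small].
  rewrite /ball /= sub0r normrN ger0_norm; last by rewrite divr_ge0 ?mulr_ge0 // ltW.
  rewrite ltr_pdivrMr // -ltr_pdivrMl // [ltLHS]mulrC.
  apply: lt_le_trans (truncnS_gt _) _.
  by rewrite ler_nat ltnS leq_maxl.
apply/andP; split=> //; apply/forallP => i; apply/eqP.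
rewrite unity_rootE unit_circleX; apply/eqP/eqP => [|iN]; last first.
  by rewrite iN mulrC divfK // mulr_natl /unit_circle cos2pi sin2pi.
apply: contra_eq => i_neqN.
have i_ltN : (i.+1 < N)%N by rewrite ltn_neqAle i_neqN ltn_ord.
have : 0 < sin (i.+1%:R * (pi / N%:R) : R).
  apply: sin_gt0_pi; rewrite mulr_gt0 ?divr_gt0 ?ltr0n //=.
  by rewrite mulrCA gtr_pMr // ltr_pdivrMr // mul1r ltr_nat.
apply: contraTN => /eqP /(congr1 (@complex.Re R)) /=.
have -> : i.+1%:R * (2 * pi / N%:R) = (i.+1%:R * (pi / N%:R)) *+ 2 :> R by ring.
rewrite cos_mulr2n => cos1.
have := cos2Dsin2 (i.+1%:R * (pi / N%:R) : R).
move=> cs; have /eqP -> : sin (i.+1%:R * (pi / N%:R) : R) == 0.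
  by rewrite -sqrf_eq0; apply/eqP; lra.
by rewrite ltxx.
Unshelve. all: by end_near. Qed.

Lemma sum_powers_root_of_unity (K : fieldType) (x : K) N :
  x ^+ N = 1 -> x != 1 -> \sum_(j < N) x ^+ j = 0.
Proof.
move=> xN x1; apply/eqP; have /eqP := subrX1 x N.
by rewrite xN subrr eq_sym mulf_eq0 subr_eq0 (negPf x1).
Qed.

(** The Cauchy kernel [w / (w - z)], expanded in powers of [z / w] and cut after
[N] terms, equals [w (1 - (z / w) ^ N) / (w - z)]. When [w ^ N] is the same for all
sample points this is the Cauchy kernel up to a constant factor, which makes its
mean exactly 1. *)
Definition geometric_kernel (K : fieldType) N (z w : K) : K :=
  \sum_(m < N) (z / w) ^+ m.

Lemma geometric_kernelM (K : fieldType) N (z w : K) : w != 0 ->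
  geometric_kernel N z w * (w - z) = w * (1 - (z / w) ^+ N).
Proof.
move=> w0; have -> : w - z = w * - (z / w - 1) by field.
by rewrite mulrCA mulrN [_ * (_ - 1)]mulrC -subrX1 opprB.
Qed.

(** Only [m = 0] survives, since the powers of a nontrivial root of unity sum
to 0. *)
Lemma geometric_kernel_mean (K : fieldType) N (omega r z : K) :
  N.-primitive_root omega -> r != 0 ->
  \sum_(j < N) geometric_kernel N z (r * omega ^+ j) = N%:R.
Proof.
move=> omega_prim r0; have N0 := prim_order_gt0 omega_prim.
have omega0 : omega != 0 by rewrite (prim_root_eq0 omega_prim) -lt0n.
rewrite exchange_big /= (bigD1 (Ordinal N0)) //= [X in _ + X]big1 ?addr0.
  under eq_bigr => j _ do rewrite expr0.
  by rewrite sumr_const card_ord.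
move=> m m0; have {}m0 : (0 < m)%N by rewrite lt0n.
transitivity ((z / r) ^+ m * \sum_(j < N) (omega ^- m) ^+ j).
  rewrite mulr_sumr; apply: eq_bigr => j _.
  by rewrite invfM mulrA exprMn -!exprVn -!exprM mulnC.
rewrite sum_powers_root_of_unity ?mulr0 //.
  by rewrite -exprVn exprAC exprVn (prim_expr_order omega_prim) invr1 expr1n.
rewrite invr_eq1 -(expr0 omega) (eq_prim_root_expr omega_prim).
by rewrite mod0n modn_small // -lt0n.
Qed.

(** The weighted mean [I s] of the values of [g] at [zeta s j = z + s (w_j - z)] runs
from [g z] at [s = 0] to the sum of the formula at [s = 1]. To first order, an
increment [h] of [s] changes it by [h kappa / N * S s], where
[S s = sum_j w_j A (zeta s j)] and the slopes [A] stand for the derivative of [g]. The sum of the increments of [g] around the closed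
polygon of vertices [zeta s j] is zero, and to first order it is
[s (omega - 1) S s]; so [S s] is small. Adding up the changes over a fine
subdivision of the interval from 0 to 1 bounds [I 1 - I 0]. A single [N] serves for
all [z] in the disc. *)
Lemma discrete_cauchy_formula (R : realType) (E : tvsType (Cplx R))
    (p : E -> R) (g : Cplx R -> E) (rho e : R) (n0 : nat) :
  is_seminorm p -> strictly_differentiable p g -> 0 < rho -> 0 < e ->
  exists N, exists2 omega : Cplx R, (n0 < N)%N /\ cabs omega = 1 &
    forall z, cabs z <= rho ->
      p (g z - N%:R^-1 *: \sum_(j < N)
           geometric_kernel N z (rho%:C%C * omega ^+ j) *:
             g (rho%:C%C * omega ^+ j)) <= e.
Proof.
move=> p_semi g_sd rho0 e0.
(* The factor 4 = 2 + 2 accounts for the two error terms [sum1] and [sum2]. *)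
pose e' := e / (4 * rho).
have e'0 : 0 < e' by rewrite divr_gt0 // mulr_gt0.
have [delta delta0 delta_unif] := uniform_strict_differentiability rho g_sd e'0.
have {delta_unif} /choice[A A_affine] zeta :
    exists A, cabs zeta <= rho -> affine_up_to p g e' delta zeta A.
  have [zeta_rho|] := leP (cabs zeta) rho; last by exists 0.
  by have [A HA] := delta_unif _ zeta_rho; exists A.
have eta0 : 0 < delta / rho by rewrite divr_gt0.
have [N [omega omega_prim [N_gt omega1 omega_fine]]] :=
  fine_root_of_unity n0.+1 eta0.
have N0 : (0 < N)%N by apply: leq_trans N_gt.
have NR0 : 0 < N%:R :> R by rewrite ltr0n.
exists N; exists omega; first by split=> //; apply: ltnW.
move=> z z_rho.
have rhoC0 : rho%:C%C != 0 :> Cplx R by rewrite -cabs_gt0 cabs_real normr_gt0 gt_eqF.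
have [w wE] : exists w : nat -> Cplx R, forall j, w j = rho%:C%C * omega ^+ j.
  by exists (fun j => rho%:C%C * omega ^+ j).
have cabs_w j : cabs (w j) = rho.
  by rewrite wE cabsM cabsX omega1 expr1n mulr1 cabs_real gtr0_norm.
have w0 j : w j != 0 by rewrite -cabs_gt0 cabs_w.
pose c j := geometric_kernel N z (w j).
pose kappa := 1 - (z / rho%:C%C) ^+ N.
have cM j : c j * (w j - z) = w j * kappa.
  rewrite /c geometric_kernelM //; congr (_ * (1 - _)).
  rewrite wE invfM mulrA exprMn exprVn exprAC (prim_expr_order omega_prim).
  by rewrite expr1n invr1 mulr1.
have kappa2 : cabs kappa <= 2.
  apply: le_trans (cabsB _ _) _; rewrite cabs1 cabsX cabsM cabsV cabs_real.
  rewrite gtr0_norm // -[leRHS]/(1 + 1) lerD2l exprn_ile1 ?divr_ge0 ?cabs_ge0 ?(ltW rho0) //.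
  by rewrite ler_pdivrMr // mul1r.
pose zeta (s : R) j := z + s%:C%C * (w j - z).
have wz j : cabs (w j - z) <= 2 * rho.
  by apply: le_trans (cabsB _ _) _; rewrite cabs_w; lra.
have zeta_rho s j : 0 <= s <= 1 -> cabs (zeta s j) <= rho.
  move=> /andP[s0 s1].
  have -> : zeta s j = (1 - s)%:C%C * z + s%:C%C * w j.
    by rewrite /zeta rmorphB rmorph1; ring.
  apply: le_trans (cabsD _ _) _; rewrite !cabsM !cabs_real cabs_w.
  rewrite !ger0_norm ?subr_ge0 //.
  have := ler_wpM2l (_ : 0 <= 1 - s) z_rho; rewrite subr_ge0 => /(_ s1); lra.
have omega_neq1 : omega != 1.
  have := eq_prim_root_expr omega_prim 1 0; rewrite expr1 expr0 => ->.
  by rewrite mod0n modn_small //; apply: leq_trans N_gt.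
pose S s := \sum_(j < N) w j *: A (zeta s j).
(* At [s = 0] the polygon is reduced to [z], all slopes coincide and the
   points [w_j] sum to 0; dividing by [s] needs [s > 0]. *)
have S_small s : 0 <= s <= 1 -> p (S s) <= N%:R * (rho * e').
  move=> s01; have [s_eq0|s_neq0] := eqVneq s 0.
    have -> : S s = (rho%:C%C * \sum_(j < N) omega ^+ j) *: A z.
      rewrite mulr_sumr scaler_suml; apply: eq_bigr => j _.
      by rewrite /zeta s_eq0 mul0r addr0 wE.
    rewrite sum_powers_root_of_unity ?(prim_expr_order omega_prim) //.
    rewrite mulr0 scale0r (seminorm0 p_semi).
    by apply: mulr_ge0; [exact: ltW|apply: mulr_ge0; exact: ltW].
  have s_gt0 : 0 < s by rewrite lt_neqAle eq_sym s_neq0; case/andP: s01.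
  have s_le1 : s <= 1 by case/andP: s01.
  have zetaS j : zeta s j.+1 - zeta s j = s%:C%C * (omega - 1) * w j.
    by rewrite /zeta !wE exprS; ring.
  have zetaS_cabs j : cabs (zeta s j.+1 - zeta s j) = s * cabs (omega - 1) * rho.
    by rewrite zetaS !cabsM cabs_real gtr0_norm // cabs_w.
  pose r j := g (zeta s j.+1) - g (zeta s j) -
     (zeta s j.+1 - zeta s j) *: A (zeta s j).
  have r_small j : p (r j) <= e' * (s * cabs (omega - 1) * rho).
    rewrite -(zetaS_cabs j); apply: (A_affine (zeta s j)); first exact: zeta_rho.
      rewrite zetaS_cabs mulrAC; apply: le_lt_trans (_ : rho * cabs (omega - 1) < _).
        by rewrite ler_wpM2r ?cabs_ge0 // ler_piMl // ltW.
      by rewrite mulrC -ltr_pdivlMr.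
    by rewrite subrr cabs0.
  have sum_r : \sum_(j < N) r j = - ((s%:C%C * (omega - 1)) *: S s).
    rewrite big_split /= sumrN -(big_mkord xpredT (fun j => g (zeta s j.+1) - g (zeta s j))).
    rewrite telescope_sumr //= /zeta !wE (prim_expr_order omega_prim) expr0 subrr add0r.
    congr (- _); rewrite scaler_sumr; apply: eq_bigr => j _.
    by rewrite scalerA -zetaS.
  have : p (\sum_(j < N) r j) <= N%:R * (e' * (s * cabs (omega - 1) * rho)).
    exact: seminorm_sum_le.
  rewrite sum_r seminormN // seminormZ // cabsM cabs_real gtr0_norm // => r_le.
  have om0 : 0 < cabs (omega - 1) by rewrite cabs_gt0 subr_eq0.
  rewrite -(ler_pM2l (mulr_gt0 s_gt0 om0)).
  apply: (le_trans r_le); rewrite le_eqVlt; apply/orP; left; apply/eqP; ring.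
pose I s := N%:R^-1 *: \sum_(j < N) c j *: g (zeta s j).
have I0 : I 0 = g z.
  rewrite /I; under eq_bigr => j _ do rewrite /zeta mul0r addr0.
  under eq_bigr => j _ do rewrite /c wE.
  rewrite -scaler_suml geometric_kernel_mean // scalerA mulVf ?scale1r //.
  by rewrite pnatr_eq0 -lt0n.
have I1 : I 1 = N%:R^-1 *: \sum_(j < N) c j *: g (w j).
  by congr (_ *: _); apply: eq_bigr => j _; rewrite /zeta mul1r addrC subrK.
have I_step s h : 0 <= s -> 0 < h -> s + h <= 1 -> h * (2 * rho) < delta ->
    p (I (s + h) - I s) <= h * e.
  move=> s0 h0 sh1 h_small.
  have s01 : 0 <= s <= 1 by rewrite s0 /=; lra.
  have sh01 : 0 <= s + h <= 1 by rewrite sh1 andbT; lra.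
  have zetah j : zeta (s + h) j - zeta s j = h%:C%C * (w j - z).
    by rewrite /zeta rmorphD; ring.
  have zetah_cabs j : cabs (zeta (s + h) j - zeta s j) = h * cabs (w j - z).
    by rewrite zetah cabsM cabs_real gtr0_norm.
  pose r j := g (zeta (s + h) j) - g (zeta s j) -
     (zeta (s + h) j - zeta s j) *: A (zeta s j).
  have r_small j : p (r j) <= e' * (h * cabs (w j - z)).
    rewrite -zetah_cabs; apply: (A_affine (zeta s j)); first exact: zeta_rho.
      by rewrite zetah_cabs; apply: le_lt_trans h_small; rewrite ler_pM2l.
    by rewrite subrr cabs0.
  have -> : I (s + h) - I s = N%:R^-1 *: (\sum_(j < N) c j *: r j +
      (h%:C%C * kappa) *: S s).
    rewrite /I -scalerBr; congr (_ *: _).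
    rewrite /S scaler_sumr -sumrB -big_split /=; apply: eq_bigr => j _.
    rewrite scalerA /r zetah !scalerBr scalerA.
    have -> : c j * (h%:C%C * (w j - z)) = h%:C%C * kappa * w j.
      by rewrite mulrCA cM; ring.
    by rewrite subrK.
  rewrite seminormZ // cabsV cabs_nat.
  rewrite mulrC ler_pdivrMr //.
  apply: le_trans (seminormD p_semi _ _) _; rewrite seminormZ //.
  have sum1 : p (\sum_(j < N) c j *: r j) <= N%:R * (2 * rho * (e' * h)).
    apply: seminorm_sum_le => // j; rewrite seminormZ //.
    apply: le_trans (ler_wpM2l (cabs_ge0 _) (r_small j)) _.
    have -> : cabs (c j) * (e' * (h * cabs (w j - z))) =
        cabs (c j * (w j - z)) * (e' * h).
      by rewrite cabsM; ring.
    by rewrite ler_pM2r ?(mulr_gt0 e'0 h0) // cM cabsM cabs_w mulrC ler_pM2r.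
  have sum2 : cabs (h%:C%C * kappa) * p (S s) <= h * 2 * (N%:R * (rho * e')).
    apply: ler_pM; rewrite ?cabs_ge0 ?seminorm_ge0 ?S_small //.
    by rewrite cabsM cabs_real gtr0_norm // ler_pM2l.
  apply: le_trans (lerD sum1 sum2) _.
  rewrite le_eqVlt; apply/orP; left; apply/eqP.
  by rewrite /e'; field; rewrite gt_eqF.
pose L := (Num.truncn (2 * rho / delta)).+1.
have L0 : 0 < L%:R :> R by rewrite ltr0n.
have L_fine : L%:R^-1 * (2 * rho) < delta.
  by rewrite mulrC ltr_pdivrMr // -ltr_pdivrMl // [ltLHS]mulrC; apply: truncnS_gt.
under eq_bigr => j _ do rewrite -wE -/(c j).
rewrite -I1 -I0 -(seminormN p_semi) opprB.
have -> : I 1 - I 0 = \sum_(l < L) (I (l.+1%:R / L%:R) - I (l%:R / L%:R)).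
  rewrite -(big_mkord xpredT (fun l => I (l.+1%:R / L%:R) - I (l%:R / L%:R))).
  by rewrite (telescope_sumr (fun l => I (l%:R / L%:R))) // divff ?gt_eqF // mul0r.
have -> : e = L%:R * (L%:R^-1 * e) by rewrite mulVKf // gt_eqF.
apply: seminorm_sum_le => // l.
have lS : l.+1%:R / L%:R = l%:R / L%:R + L%:R^-1 :> R.
  by rewrite -[l.+1%:R]natr1 mulrDl mul1r.
rewrite lS; apply: I_step => //.
by rewrite invr_gt0.
by rewrite -lS ler_pdivrMr // mul1r ler_nat.
Qed.

(** * Polynomial growth *)

Lemma sum_powers_le2 (R : realFieldType) (x : R) n :
  0 <= x <= 2^-1 -> \sum_(m < n) x ^+ m <= 2.
Proof.
move=> /andP[x0 x2]; elim: n => [|n IH]; first by rewrite big_ord0.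
rewrite big_ord_recl expr0.
under eq_bigr => m _ do rewrite lift0 exprS.
rewrite -mulr_sumr.
have sum_ge0 : 0 <= \sum_(m < n) x ^+ m.
  by apply: sumr_ge0 => m _; exact: exprn_ge0.
have := ler_pM x0 sum_ge0 x2 IH; lra.
Qed.

Lemma geometric_kernel_tail (R : realType) k n (z w : Cplx R) :
  2 * cabs z <= cabs w -> w != 0 ->
  cabs (geometric_kernel (k + n) z w - geometric_kernel k z w) <=
  2 * (cabs z / cabs w) ^+ k.
Proof.
move=> zw w0; have cw0 : 0 < cabs w by rewrite cabs_gt0.
rewrite /geometric_kernel big_split_ord /= addrAC subrr add0r.
under eq_bigr => m _ do rewrite exprD.
rewrite -mulr_sumr cabsM cabsX cabsM cabsV mulrC.
apply: ler_wpM2r; first by rewrite exprn_ge0 // divr_ge0 // cabs_ge0.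
apply: le_trans (cabs_sum _ _ _) _.
under eq_bigr => m _ do rewrite cabsX cabsM cabsV.
apply: sum_powers_le2; rewrite divr_ge0 ?cabs_ge0 //= ler_pdivrMr //; lra.
Qed.

(** The coefficients [b m] are the discrete Cauchy coefficients on a circle of
large radius [rho]. The part of the kernel beyond degree [k] is at most
[2 (M / rho) ^ (k + 1)], against values of [g] of size [C rho ^ k]. *)
Lemma growth_polynomial_approximation (R : realType) (E : tvsType (Cplx R))
    (p : E -> R) (g : Cplx R -> E) (k : nat) (C r M e : R) :
  is_seminorm p -> strictly_differentiable p g -> 0 < C ->
  (forall t, r <= cabs t -> p (g t) <= C * cabs t ^+ k) ->
  0 < M -> 0 < e ->
  exists b : nat -> E, forall z, cabs z <= M ->
    p (g z - \sum_(m < k.+1) z ^+ m *: b m) <= e.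
Proof.
move=> p_semi g_sd C0 g_growth M0 e0.
(* With [T <= rho] the tail [2 (M / rho) ^ (k + 1) * C rho ^ k] is at most [e / 2]. *)
pose T := 4 * C * M ^+ k.+1 / e.
have T0 : 0 < T by rewrite divr_gt0 // mulr_gt0 ?exprn_gt0 // mulr_gt0.
have [rho [rho_r rho_M rho_T]] : exists rho, [/\ r <= rho, 2 * M <= rho & T <= rho].
  exists (`|r| + 2 * M + T); have := ler_norm r; have := normr_ge0 r.
  by split; lra.
have rho0 : 0 < rho by apply: lt_le_trans rho_T.
have e20 : 0 < e / 2 by rewrite divr_gt0.
have [N [omega [kN omega1] cauchy]] :=
  discrete_cauchy_formula k p_semi g_sd rho0 e20.
have [n NE] : exists n, N = (k.+1 + n)%N by exists (N - k.+1)%N; rewrite subnKC.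
have NR0 : 0 < N%:R :> R by rewrite NE ltr0n.
have [w wE] : exists w : nat -> Cplx R, forall j, w j = rho%:C%C * omega ^+ j.
  by exists (fun j => rho%:C%C * omega ^+ j).
have cabs_w j : cabs (w j) = rho.
  by rewrite wE cabsM cabsX omega1 expr1n mulr1 cabs_real gtr0_norm.
have w0 j : w j != 0 by rewrite -cabs_gt0 cabs_w.
exists (fun m => N%:R^-1 *: \sum_(j < N) w j ^- m *: g (w j)) => z zM.
have z_rho : cabs z <= rho by apply: le_trans zM _; lra.
have /= := cauchy _ z_rho.
under eq_bigr => j _ do rewrite -wE.
set S := \sum_(j < N) _ => gS.
have -> : \sum_(m < k.+1) z ^+ m *: (N%:R^-1 *: \sum_(j < N) w j ^- m *: g (w j)) =
    N%:R^-1 *: \sum_(j < N) geometric_kernel k.+1 z (w j) *: g (w j).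
  under eq_bigr => m _ do rewrite scalerA mulrC -scalerA scaler_sumr.
  rewrite -scaler_sumr exchange_big /=; congr (_ *: _).
  apply: eq_bigr => j _; rewrite scaler_suml; apply: eq_bigr => m _.
  by rewrite scalerA exprMn exprVn.
set S' := \sum_(j < N) _.
have -> : g z - N%:R^-1 *: S' = (g z - N%:R^-1 *: S) + N%:R^-1 *: (S - S').
  by rewrite scalerBr subrKA.
apply: le_trans (seminormD p_semi _ _) _.
suff : p (N%:R^-1 *: (S - S')) <= e / 2 by lra.
rewrite seminormZ // cabsV cabs_nat mulrC ler_pdivrMr // mulrC.
rewrite /S /S' -sumrB; apply: seminorm_sum_le => // j.
rewrite -scalerBl seminormZ //.
have gw : p (g (w j)) <= C * rho ^+ k by rewrite -(cabs_w j) g_growth // cabs_w.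
have tail : cabs (geometric_kernel N z (w j) - geometric_kernel k.+1 z (w j)) <=
    2 * (M / rho) ^+ k.+1.
  move: (w j) (cabs_w j) (w0 j) => x cabs_x x0; rewrite NE.
  apply: le_trans (geometric_kernel_tail _ _ _ _) _ => //.
    by rewrite cabs_x; lra.
  rewrite cabs_x ler_pM2l // lerXn2r ?nnegrE ?divr_ge0 ?cabs_ge0 ?(ltW rho0) ?(ltW M0) //.
  by rewrite ler_pM2r // invr_gt0.
apply: le_trans (ler_pM (cabs_ge0 _) (seminorm_ge0 p_semi _) tail gw) _.
have -> : 2 * (M / rho) ^+ k.+1 * (C * rho ^+ k) = (T / rho) * (e / 2).
  rewrite /T expr_div_n [rho ^+ k.+1]exprS; field.
  by rewrite expf_neq0 ?gt_eqF.
by apply: ler_piMl; [exact: ltW|rewrite ler_pdivrMr // mul1r].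
Qed.

(** The map sending [g] to [g z - interpolant k g z] vanishes on polynomials of
degree at most [k] and involves finitely many values of [g], so approximation by
such polynomials on a disc containing [z] and the nodes makes it vanish on [g]. *)
Lemma polynomial_growth_interpolant (R : realType) (E : tvsType (Cplx R))
    (p : E -> R) (g : Cplx R -> E) (k : nat) (C r : R) :
  is_seminorm p -> strictly_differentiable p g -> 0 < C ->
  (forall t, r <= cabs t -> p (g t) <= C * cabs t ^+ k) ->
  forall z, p (g z - interpolant k g z) = 0.
Proof.
move=> p_semi g_sd C0 g_growth z.
apply/eqP; rewrite eq_le seminorm_ge0 // andbT.
pose B := 1 + \sum_(i < k.+1) cabs (lagrange_nat (Cplx R) i).[z].
have B0 : 0 < B by rewrite ltr_pwDl // sumr_ge0 // => i _; exact: cabs_ge0.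
apply/ler_addgt0Pr => e e0; rewrite add0r.
pose M := cabs z + k.+1%:R.
have M0 : 0 < M by rewrite ltr_wpDl ?cabs_ge0 // ltr0n.
have eB0 : 0 < e / B by rewrite divr_gt0.
have [b approx] := growth_polynomial_approximation p_semi g_sd C0 g_growth M0 eB0.
pose P t := \sum_(m < k.+1) t ^+ m *: b m.
have -> : g z - interpolant k g z = (g z - P z) - interpolant k (g \- P) z.
  have -> : interpolant k (g \- P) z = interpolant k g z - P z.
    rewrite -[P z]interpolant_polynomial /interpolant -sumrB.
    by apply: eq_bigr => i _; rewrite scalerBr.
  by rewrite opprB subrKA.
apply: le_trans (seminormB p_semi _ _) _.
have -> : e = e / B + (\sum_(i < k.+1) cabs (lagrange_nat (Cplx R) i).[z]) * (e / B).
  by rewrite -[X in _ = X + _]mul1r -mulrDl mulrC divfK ?gt_eqF.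
apply: lerD; first by apply: approx; rewrite lerDl.
apply: le_trans (seminorm_sum p_semi _ _ _) _.
rewrite mulr_suml; apply: ler_sum => i _; rewrite seminormZ //.
apply: ler_wpM2l; first exact: cabs_ge0.
apply: approx; rewrite cabs_nat; apply: le_trans (_ : k.+1%:R <= _).
  by rewrite ler_nat ltnW.
by rewrite lerDr cabs_ge0.
Qed.

Lemma polynomial_growth (R : realType) (E : tvsType (Cplx R)) (p : E -> R)
    (d k : nat) (f : 'rV[Cplx R]_d -> E) :
  is_seminorm p -> is_polynomial k f ->
  exists2 C : R, 0 < C &
    forall z, 1 <= enorm z -> p (f z) <= C * enorm z ^+ k.
Proof.
move=> p_semi [a fE].
exists (1 + \sum_(b : {ffun 'I_d -> 'I_k.+1} | (\sum_j b j <= k)%N) p (a b)).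
  by rewrite ltr_pwDl // sumr_ge0 // => b _; exact: seminorm_ge0.
move=> z z1; rewrite fE mulrDl mul1r.
apply: le_trans (seminorm_sum p_semi _ _ _) _.
rewrite -[leLHS]add0r; apply: lerD; first by rewrite exprn_ge0 // enorm_ge0.
rewrite mulr_suml; apply: ler_sum => b bk; rewrite seminormZ // mulrC.
apply: ler_wpM2l; first exact: seminorm_ge0.
apply: le_trans (_ : \prod_j enorm z ^+ b j <= _).
  rewrite (big_morph (@cabs R) (@cabsM R) (@cabs1 R)).
  apply: ler_prod => j _; rewrite cabs_ge0 cabsX /=.
  by rewrite lerXn2r ?nnegrE ?cabs_ge0 ?enorm_ge0 // cabs_le_enorm.
by rewrite prodrXr ler_weXn2l.
Qed.

Lemma seminorms_separate (R : realType) (E : tvsType (Cplx R)) (I : Type)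
    (p : I -> E -> R) (x : E) :
  hausdorff_space E -> directed_fundamental_system p ->
  (forall i, p i x = 0) -> x = 0.
Proof.
move=> E_hausdorff [_ _ p_basis] px; apply/esym/E_hausdorff => U V U0 Vx.
exists x; split; last exact: nbhs_singleton.
have [i [e e0 pU]] := (p_basis U).1 U0.
by apply: pU; rewrite /= px.
Qed.

(** Through the embedding, smallness in the completion controls the seminorms
of E, without extending these to the completion. *)
Lemma embedding_seminorm (R : realType) (E Ehat : tvsType (Cplx R))
    (j : {linear E -> Ehat}) (I : Type) (p : I -> E -> R) (i : I) (e : R) :
  is_completion j -> directed_fundamental_system p -> 0 < e ->
  exists2 V : set Ehat, nbhs 0 V & forall x, V (j x) -> p i x < e.
Proof.
move=> [_ _ j_emb _] [_ _ p_basis] e0.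
have : nbhs 0 [set x | p i x < e] by apply/p_basis; exists i, e.
by move=> /j_emb[V V0 Vp]; exists V.
Qed.

Lemma holomorphic_line_strictly_differentiable (R : realType)
    (E Ehat : tvsType (Cplx R)) (j : {linear E -> Ehat}) (I : Type)
    (p : I -> E -> R) (i : I) (d : nat) (f : 'rV[Cplx R]_d -> E)
    (a v : 'rV[Cplx R]_d) :
  is_completion j -> directed_fundamental_system p -> holomorphic j f ->
  v != 0 -> strictly_differentiable (p i) (fun t => f (a + t *: v)).
Proof.
move=> hj hp hf v0; have [p_semi _ _] := hp; have [_ _ _ j_dense] := hj.
have [G G_cont G_deriv] := holomorphic_line_derivative a hf v0.
apply: (strictly_differentiable_of_derivative (p_semi i) j_dense _ G_cont G_deriv).
by move=> e; apply: embedding_seminorm.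
Qed.

Theorem theorem7p3 (R : realType) (E : tvsType (Cplx R))
  (hE0 : exists x : E, x != 0)
  (hE : hausdorff_space E)
  (hlc : locally_complete E)
  (Ehat : tvsType (Cplx R)) (j : {linear E -> Ehat}) (hj : is_completion j)
  (I : Type) (p : I -> E -> R) (hp : directed_fundamental_system p)
  (d : nat) (f : 'rV[Cplx R]_d -> E) (hf : holomorphic j f) (k : nat) :
  is_polynomial k f <->
  (forall i : I, exists C r : R, 0 < C /\ 0 < r /\
     forall z : 'rV[Cplx R]_d, r <= enorm z -> p i (f z) <= C * enorm z ^+ k).
Proof.
have [p_semi _ _] := hp; split=> [f_poly i|f_growth].
  have [C C0 fC] := polynomial_growth (p_semi i) f_poly.
  by exists C, 1; split.
apply: is_polynomial_of_lines => a v t; apply/eqP; rewrite -subr_eq0; apply/eqP.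
have [->|v0] := eqVneq v 0.
  have -> : (fun s : Cplx R => f (a + s *: 0)) = fun=> f (a + t *: 0).
    by apply/funext => s; rewrite !scaler0.
  by rewrite interpolant_cst subrr.
apply: (seminorms_separate hE hp) => i.
have [C [r [C0 [_ fC]]]] := f_growth i.
have [C' [r' [C'0 lineC]]] := line_growth a C0 v0 fC.
exact: (polynomial_growth_interpolant (p_semi i)
  (holomorphic_line_strictly_differentiable i a hj hp hf v0) C'0 lineC).
Qed.
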